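(* Let $c,d\ge 1$ be integers with $d\ge 6c$, and let $h:\Phi^c\to\Psi^d$ be a random simple tabulation function whose character tables are fully random. Consider the asymptotic regime $|\Phi|\to\infty$ in which $c=|\Phi|^{o(1)}$ and $(c+d)^c=|\Psi|^{o(1)}$ (the parameters $c,d,|\Psi|$ may depend on $|\Phi|$). Let $k=|\Psi|^{1/(5c)}$. Then: (a) With probability $1-o\big(|\Phi|^2/|\Psi|^{d/(2c)}\big)$, every key set $X\subseteq\Phi^c$ with $1\le |X|\le k$ has at least one unique output position character. (b) For any $\varepsilon\in(0,1)$, with probability $1-o\big(|\Phi|^2/|\Psi|^{\varepsilon d/(2c)}\big)$, every key set $X\subseteq\Phi^c$ with $1\le|X|\le k$ has more than $(1-\varepsilon)d|X|$ distinct output position characters. Moreover, the same conclusions (a) and (b), with $k$ replaced by any $k\le|\Psi|^{1/(5c)}$ (i.e., for all $X$ with $|X|\le k$), hold with the same probability bounds if the character tables are not fully random but are mutually independent and each $k$-independent.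
   Context: Let $\Psi=[2^m]=\{0,\dots,2^m-1\}$, identified with $m$-bit strings, and let $\oplus$ denote bitwise exclusive-or, applied coordinatewise on $\Psi^d$. For $y\in\Psi^d$, $y_j$ denotes its $j$-th coordinate, $j\in[d]=\{0,\dots,d-1\}$. A simple tabulation function $h:\Phi^c\to\Psi^d$ is given by character tables $h_0,\dots,h_{c-1}:\Phi\to\Psi^d$ and defined by $h(x)=h_0(x_0)\oplus\cdots\oplus h_{c-1}(x_{c-1})$ for $x=(x_0,\dots,x_{c-1})$. The tables are fully random if all values $h_i(a)$ ($i\in[c]$, $a\in\Phi$) are independent and uniform in $\Psi^d$. A table $h_i$ is $k$-independent if for any $k$ distinct $a_1,\dots,a_k\in\Phi$ the values $h_i(a_1),\dots,h_i(a_k)$ are independent and each uniform in $\Psi^d$. An output position character is a pair $(j,a)\in[d]\times\Psi$. A set $X\subseteq\Phi^c$ has a unique output position character $(j,a)$ if there is exactly one $x\in X$ with $h(x)_j=a$. The distinct output position characters of $X$ are the elements of $\{(j,h(x)_j): x\in X, j\in[d]\}$. *)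

(* Defs.v *)
From Stdlib Require Import Reals.
From mathcomp Require Import all_boot.

Set Implicit Arguments.
Unset Strict Implicit.
Unset Printing Implicit Defensive.

(* Psi = [2^m], identified with m-bit strings. *)
Notation Psi m := {ffun 'I_m -> bool}.
Notation Out m d := {ffun 'I_d -> Psi m}.
Notation Key n c := {ffun 'I_c -> 'I_n}.
Notation Table n m d := {ffun 'I_n -> Out m d}.
Notation Tables n c m d := {ffun 'I_c -> Table n m d}.

Definition xorv m d (y z : Out m d) : Out m d :=
  [ffun j => [ffun b => y j b (+) z j b]].
Definition zerov m d : Out m d := [ffun _ => [ffun _ => false]].

Definition htab n c m d (T : Tables n c m d) (x : Key n c) : Out m d :=
  foldr (fun i acc => xorv (T i (x i)) acc) (zerov m d) (enum 'I_c).

Definition has_unique_opc n c m d (T : Tables n c m d) (X : {set Key n c}) : bool :=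
  [exists j : 'I_d, exists a : Psi m, #|[set x in X | htab T x j == a]| == 1%N].

Definition n_opc n c m d (T : Tables n c m d) (X : {set Key n c}) : nat :=
  #|[set (j, htab T x j) | x in X, j in [set: 'I_d]]|.

Definition Rleb (x y : R) : bool := if Rle_dec x y then true else false.
Definition Rltb (x y : R) : bool := if Rlt_dec x y then true else false.

Definition failA n c m d (k : R) (T : Tables n c m d) : bool :=
  [exists X : {set Key n c},
     [&& (0 < #|X|)%N, Rleb (INR #|X|) k & ~~ has_unique_opc T X]].

Definition many_opc n c m d (eps : R) (T : Tables n c m d) (X : {set Key n c}) : bool :=
  Rltb (Rmult (Rmult (Rminus 1 eps) (INR d)) (INR #|X|)) (INR (n_opc T X)).

Definition failB n c m d (eps k : R) (T : Tables n c m d) : bool :=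
  [exists X : {set Key n c},
     [&& (0 < #|X|)%N, Rleb (INR #|X|) k &
         ~~ many_opc eps T X]].

Definition prob n c m d (w : 'I_c -> Table n m d -> R)
    (E : Tables n c m d -> bool) : R :=
  \big[Rplus/R0]_(T : Tables n c m d | E T) \big[Rmult/R1]_(i : 'I_c) w i (T i).

Definition unif n c m d : 'I_c -> Table n m d -> R :=
  fun _ _ => Rinv (INR #|{: Table n m d}|).

Definition kindep n m d (K : nat) (w : Table n m d -> R) : Prop :=
  (forall f, Rle R0 (w f)) /\
  forall (S : {set 'I_n}) (y : Table n m d), (#|S| <= K)%N ->
    \big[Rplus/R0]_(f : Table n m d | [forall a in S, f a == y a]) w f
      = pow (Rinv (INR #|{: Out m d}|)) #|S|.

Definition eventually (P : nat -> Prop) : Prop :=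
  exists N, forall n, (N <= n)%N -> P n.

(* f = g^{o(1)} (for f >= 1, g >= 1) *)
Definition small_pow (f g : nat -> R) : Prop :=
  forall eps : R, Rlt R0 eps -> eventually (fun n => Rle (f n) (Rpower (g n) eps)).

Definition little_o (f g : nat -> R) : Prop :=
  forall eps : R, Rlt R0 eps -> eventually (fun n => Rle (Rabs (f n)) (Rmult eps (g n))).

(* Main.v *)
(** For [X] with few output position characters, list the input position
characters of [X] as a_0, a_1, ... by decreasing number occ(a_p) of keys
containing them. If two keys of [X] agree on output coordinate j, look at the
last character a_p in their symmetric difference: h(a_p)_j is then an xor of
fewer than 2c values h(a_q)_j with q < p ("p is bad at j"). Keys without bad
characters have distinct outputs at j, so with m_p the number of j at which p is
bad, sum_p m_p occ(a_p) >= theta d |X| = (theta d / c) sum_p occ(a_p), and Abel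
summation gives a prefix of some length r >= 2 with
m_0 + ... + m_{r-1} >= theta d r / c. The prefix has at most |X| characters per
position, so its values are independent and uniform, and revealing them one by
one bounds E[lam^(sum m_p)] by 2^(d r) as long as lam r^(2c) <= |Psi|. A union
bound over prefixes leaves a geometric series of ratio
rho = c |Phi| 2^d lam^(-theta d / c), dominated by its first term rho^2.
Both (a), with e = 1, and (b), with e = eps, follow from theta = e / 2. *)

From Stdlib Require Import Reals Lra.

(** * Real inequalities behind the choice of exponents *)

Section RealBounds.
Local Open Scope R_scope.

Lemma pow_exp (a : R) (n : nat) : exp a ^ n = exp (INR n * a).
Proof.
induction n as [|n IHn].
- now rewrite Rmult_0_l, exp_0.
- rewrite S_INR; simpl; rewrite IHn, <- exp_plus; f_equal; ring.
Qed.

Lemma exp_le_mono (a b : R) : a <= b -> exp a <= exp b.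
Proof.
intros [lt | ->]; [left; now apply exp_increasing | right; reflexivity].
Qed.

Lemma ln_le_mono (a b : R) : 0 < a -> a <= b -> ln a <= ln b.
Proof.
intros a_gt0 [lt | ->]; [left; now apply ln_increasing | right; reflexivity].
Qed.

(** If [ln Ps] were below [B], then [Ps^(ln 2 / B)] would be below 2. Applied with [Q = (c+d)^c],
    this extracts |Psi| -> infinity from the growth condition. *)
Lemma ln_ge_of_Rpower (Ps B Q : R) :
  0 < B -> 2 <= Q -> Q <= Rpower Ps (ln 2 / B) -> B <= ln Ps.
Proof.
intros B_gt0 Q_ge Q_le; apply Rnot_lt_le; intros lt.
assert (ln2_gt0 : 0 < ln 2) by (rewrite <- ln_1; apply ln_increasing; lra).
apply (Rlt_irrefl 2), Rle_lt_trans with (1 := Rle_trans _ _ _ Q_ge Q_le).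
rewrite <- (exp_ln 2) at 2 by lra; apply exp_increasing.
apply Rlt_le_trans with (ln 2 / B * B).
- apply Rmult_lt_compat_l; [now apply Rdiv_lt_0_compat | exact lt].
- right; field; lra.
Qed.

Lemma exp_opp_le (a x L : R) :
  0 < a -> 0 < x -> - ln x / a <= L -> exp (- (a * L)) <= x.
Proof.
intros a_gt0 x_gt0 le; rewrite <- (exp_ln x) at 1 by exact x_gt0; apply exp_le_mono.
apply Rmult_le_compat_l with (r := a) in le; [|lra].
replace (a * (- ln x / a)) with (- ln x) in le by (field; lra).
lra.
Qed.

Section Params.
Variables (c d : nat) (N K Ps e dlt : R).
Let C := INR c.
Let D := INR d.
Let eta := e / 100.
Let L := ln Ps.
(* (C K)^(2c) <= Ps^(2/5 + 2 eta), so this choice gives lam (C K)^(2c) <= Ps;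
[q] is lam^(theta d / c) with theta = e / 2. *)
Let lam := Rpower Ps (3 / 5 - 2 * eta).
Let q := Rpower Ps ((3 / 10 - eta) * e * (D / C)).
Let rho := C * N * 2 ^ d / q.
Let bound := N ^ 2 / Rpower Ps (e * D / (2 * C)).

Hypotheses (e_gt0 : 0 < e) (e_le1 : e <= 1) (C_ge1 : 1 <= C) (D_ge : 6 * C <= D).
Hypotheses (Ps_gt1 : 1 < Ps) (N_ge0 : 0 <= N) (K_ge0 : 0 <= K).
Hypothesis K_le : K <= Rpower Ps (/ (5 * C)).
Hypothesis Q_le : (C + D) ^ c <= Rpower Ps eta.
Hypothesis Ps_large : exp (- (3 / 10 * e * L)) <= dlt / 4.
Hypothesis bound_lt : dlt * bound < 1.

Let L_gt0 : 0 < L.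
Proof. unfold L; rewrite <- ln_1; apply ln_increasing; lra. Qed.

Let C_lnCD : C * ln (C + D) <= eta * L.
Proof.
apply Rnot_lt_le; intros lt; apply (Rlt_not_le _ _ (exp_increasing _ _ lt)).
replace (exp (C * ln (C + D))) with ((C + D) ^ c); [exact Q_le|].
rewrite <- Rpower_pow; [reflexivity | lra].
Qed.

Lemma one_le_lam : 1 <= lam.
Proof.
rewrite <- exp_0; apply exp_le_mono; fold L; apply Rmult_le_pos; unfold eta; lra.
Qed.

Lemma q_pos : 0 < q.
Proof. apply exp_pos. Qed.

Lemma lam_room : lam * (C * K) ^ (2 * c) <= Ps.
Proof.
assert (lnC : C * ln C <= eta * L).
{ apply Rle_trans with (2 := C_lnCD); apply Rmult_le_compat_l; [lra|].
  apply ln_le_mono; lra. }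
apply Rle_trans with (lam * exp (INR (2 * c) * (ln C + / (5 * C) * L))).
- apply Rmult_le_compat_l; [left; apply exp_pos|].
  rewrite <- pow_exp, exp_plus, exp_ln by lra.
  apply pow_incr; split; [apply Rmult_le_pos; lra|].
  apply Rmult_le_compat_l; [lra | exact K_le].
- unfold lam, Rpower; fold L; rewrite <- exp_plus.
  rewrite <- (exp_ln Ps) at 1 by lra; fold L; apply exp_le_mono.
  rewrite mult_INR; fold C; simpl (INR 2).
  replace ((1 + 1) * C * (ln C + / (5 * C) * L)) with (2 * (C * ln C) + 2 / 5 * L) by (field; lra).
  lra.
Qed.

(** The form Markov's inequality needs: here [r] is the length of a prefix and [t] its score. *)
Lemma q_le_lam (r t : nat) : e / 2 * D * INR r <= C * INR t -> q ^ r <= lam ^ t.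
Proof.
intros le; unfold q, lam, Rpower; fold L; rewrite !pow_exp; apply exp_le_mono.
assert (E : INR r * (e / 2 * (D / C)) <= INR t).
{ apply Rmult_le_reg_l with C; [lra|].
  replace (C * (INR r * (e / 2 * (D / C)))) with (e / 2 * D * INR r) by (field; lra).
  exact le. }
replace (INR r * ((3 / 10 - eta) * e * (D / C) * L))
  with ((INR r * (e / 2 * (D / C))) * ((3 / 5 - 2 * eta) * L)) by (field; lra).
apply Rmult_le_compat_r; [|exact E].
apply Rmult_le_pos; unfold eta; lra.
Qed.

(** Count exponents of [Ps] in units of [e], with [t = D / C]. The factors C^2 and 4^d cost at most
    2/100 and t/100, while q^(-2) gains at least 58t/100. The target uses t/2 of this, and [t >= 6]
    leaves more than the 3/10 that [Ps_large] turns into [dlt / 4]. *)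
Let rho_sqr : rho ^ 2 <= dlt / 4 * bound.
Proof.
set (t := D / C).
assert (t_ge : 6 <= t).
{ unfold t; apply Rmult_le_reg_r with C; [lra|].
  replace (D / C * C) with D by (field; lra); exact D_ge. }
assert (Dt : D = t * C) by (unfold t; field; lra).
assert (C2 : C ^ 2 <= exp (2 * (eta * L))).
{ replace (exp (2 * (eta * L))) with (exp (eta * L) ^ 2) by (rewrite pow_exp; simpl; f_equal; ring).
  apply pow_incr; split; [lra|].
  rewrite <- (exp_ln C) by lra; apply exp_le_mono.
  apply Rle_trans with (2 := C_lnCD).
  assert (0 <= ln C) by (rewrite <- ln_1; apply ln_le_mono; lra).
  assert (ln C <= ln (C + D)) by (apply ln_le_mono; lra).
  apply Rle_trans with (1 * ln (C + D)); [lra|].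
  apply Rmult_le_compat_r; lra. }
(* Here 4 <= C + D, and D = t C turns (C + D)^D into the t-th power of (C + D)^C. *)
assert (D4 : (2 ^ d) ^ 2 <= exp (t * (eta * L))).
{ rewrite <- pow_mult, Nat.mul_comm, pow_mult.
  apply Rle_trans with (exp (ln (C + D)) ^ d).
  - apply pow_incr; rewrite exp_ln by lra; simpl; lra.
  - rewrite pow_exp; fold D; apply exp_le_mono; rewrite Dt at 1.
    rewrite Rmult_assoc; apply Rmult_le_compat_l; lra. }
assert (bnd_eq : bound = N ^ 2 * exp (- (e * t / 2 * L))).
{ unfold bound, Rdiv, Rpower; rewrite <- exp_Ropp; fold L.
  do 3 f_equal; unfold t; field; lra. }
assert (rho_eq : rho ^ 2 = N ^ 2 * (C ^ 2 * (2 ^ d) ^ 2 * exp (- (2 * ((3 / 10 - eta) * e * t * L))))).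
{ replace (exp (- (2 * ((3 / 10 - eta) * e * t * L)))) with (/ q ^ 2).
  - unfold rho; field; apply Rgt_not_eq, q_pos.
  - unfold q, Rpower; fold L; fold t; rewrite pow_exp, exp_Ropp; simpl (INR 2); do 2 f_equal; ring. }
rewrite rho_eq, bnd_eq.
replace (dlt / 4 * (N ^ 2 * exp (- (e * t / 2 * L))))
  with (N ^ 2 * (dlt / 4 * exp (- (e * t / 2 * L)))) by ring.
apply Rmult_le_compat_l; [apply pow_le; exact N_ge0|].
apply Rle_trans with (exp (2 * (eta * L)) * exp (t * (eta * L)) * exp (- (2 * ((3 / 10 - eta) * e * t * L)))).
- apply Rmult_le_compat_r; [left; apply exp_pos|].
  apply Rmult_le_compat; try assumption; apply pow_le; [lra | apply pow_le; lra].
- apply Rle_trans with (exp (- (3 / 10 * e * L)) * exp (- (e * t / 2 * L))).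
  2: { apply Rmult_le_compat_r; [left; apply exp_pos | exact Ps_large]. }
  rewrite <- !exp_plus; apply exp_le_mono.
  assert (eL : 0 < e * L) by (apply Rmult_lt_0_compat; assumption).
  assert (etL : 6 * (e * L) <= t * (e * L)) by (apply Rmult_le_compat_r; lra).
  assert (eetL : e * (t * (e * L)) <= 1 * (t * (e * L))) by (apply Rmult_le_compat_r; lra).
  unfold eta; lra.
Qed.

(** By [bound_lt], the preceding estimate puts [rho ^ 2] below 1/4. *)
Lemma rho_le_half : rho <= / 2.
Proof.
apply Rnot_lt_le; intros lt.
assert (/ 2 * / 2 < rho * rho) by (apply Rmult_le_0_lt_compat; lra).
assert (rho * rho <= dlt / 4 * bound) by (apply Rle_trans with (2 := rho_sqr); simpl; lra).
lra.
Qed.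

Lemma rho_sqr_le : 2 * rho ^ 2 <= dlt * bound.
Proof.
assert (0 <= rho ^ 2) by (apply pow2_ge_0).
lra.
Qed.

End Params.

End RealBounds.

Require Import Defs.
From mathcomp Require Import all_boot all_order all_algebra ring lra.
From mathcomp Require Import Rstruct.
Set Implicit Arguments.
Unset Strict Implicit.
Unset Printing Implicit Defensive.
Import Order.TTheory GRing.Theory Num.Theory.
Local Open Scope ring_scope.

(** * Xor as the addition of a group of exponent two *)

Lemma xorvE m d (y z : Out m d) : xorv y z = y + z.
Proof. by apply/ffunP=> j; apply/ffunP=> b; rewrite !ffunE. Qed.

Lemma zerovE m d : zerov m d = 0.
Proof. by apply/ffunP=> j; apply/ffunP=> b; rewrite !ffunE. Qed.

Lemma htabE n c m d (T : Tables n c m d) x : htab T x = \sum_i T i (x i).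
Proof.
rewrite /htab zerovE -[RHS]big_enum /= unlock /reducebig.
by elim: (enum _) => //= i s <-; rewrite xorvE.
Qed.

Lemma addPsi m (y : Psi m) : y + y = 0.
Proof. by apply/ffunP=> b; rewrite !ffunE; exact: addbb. Qed.

(** * Bad coordinates and their moment generating function *)

Section Score.
Variables (c m d : nat).
Implicit Types (acc : seq (Out m d)) (a : Out m d).

(* [acc] lists the values of the earlier characters, most recent first, and [b]
is an xor of j-th coordinates of at most 2c of them: the out-of-range index
[size acc] selects 0. A first character is never bad, hence [0 < size acc]. *)
Definition reach acc (j : 'I_d) (b : Psi m) : bool :=
  (0 < size acc)%N &&
  [exists L : {ffun 'I_c * bool -> 'I_(size acc).+1},
     b == \sum_z (nth 0 acc (L z) : Out m d) j].

Definition nreach acc a : nat := #|[set j | reach acc j (a j)]|.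

(** The sum of the m_p: each head is judged against its tail, that is, against the values revealed
    before it. *)
Fixpoint score acc : nat :=
  if acc is a :: acc' then (nreach acc' a + score acc')%N else 0.

Lemma reach_sum acc j (v : 'I_c * bool -> Out m d) :
  (0 < size acc)%N -> (forall z, v z \in 0 :: acc) ->
  reach acc j (\sum_z v z j).
Proof.
move=> acc_gt0 vP; rewrite /reach acc_gt0 /=; apply/existsP.
exists [ffun z => inord (index (v z) acc)]; apply/eqP.
apply: eq_bigr => z _; rewrite ffunE inordK ?ltnS ?index_size //.
have := vP z; rewrite inE => /orP[/eqP->|/nth_index->//].
by have [/nth_index-> //|?] := boolP (0 \in acc); rewrite nth_default // memNindex.
Qed.

Lemma card_reach acc j :
  (#|[set b | reach acc j b]| <= (size acc).+1 ^ (2 * c))%N.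
Proof.
rewrite [X in (_ <= X)%N](_ : _ = #|{: {ffun 'I_c * bool -> 'I_(size acc).+1}}|); last first.
  by rewrite card_ffun card_prod card_bool !card_ord mulnC.
rewrite -cardsT.
pose S (L : {ffun 'I_c * bool -> 'I_(size acc).+1}) :=
  \sum_z (nth 0 acc (L z) : Out m d) j.
apply: leq_trans (leq_imset_card S _); apply/subset_leq_card/subsetP => b.
by rewrite inE => /andP[_ /existsP[L /eqP->]]; apply/imsetP; exists L.
Qed.

Section MGF.
Variables (F : realFieldType) (lam : F) (r : nat).
Hypothesis lam_ge1 : 1 <= lam.
Let D : F := (r ^ (2 * c))%:R.
Let Psi_card : F := (2 ^ m)%:R.

(** The weight [lam ^+ nreach acc a] is a product over coordinates, so the sum is a product of sums.
    In each coordinate at most r^(2c) values are reachable and weigh [lam]; the at most 2^m others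
    weigh 1. *)
Lemma mgf_nreach acc : (size acc < r)%N ->
  \sum_a lam ^+ nreach acc a <= (Psi_card + lam * D) ^+ d.
Proof.
move=> lt_r; have lam_ge0 : 0 <= lam by apply: le_trans lam_ge1.
pose w j (b : Psi m) := if reach acc j b then lam else 1.
rewrite (eq_bigr (fun a : Out m d => \prod_j w j (a j))); last first.
  move=> a _; rewrite /w -big_mkcond prodr_const /=.
  by congr (_ ^+ _); apply: eq_card => j; rewrite inE.
rewrite -(bigA_distr_bigA w) /=.
have -> : (Psi_card + lam * D) ^+ d = \prod_(j < d) (Psi_card + lam * D).
  by rewrite prodr_const card_ord.
apply: ler_prod => j _; apply/andP; split.
  by apply: sumr_ge0 => b _; rewrite /w; case: ifP.
rewrite (bigID (reach acc j)) /= addrC lerD //.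
  rewrite (eq_bigr (fun=> 1)); last by move=> b /negbTE; rewrite /w => ->.
  rewrite sumr_const ler_nat; apply: leq_trans (max_card _) _.
  by rewrite card_ffun card_bool card_ord.
rewrite (eq_bigr (fun=> lam)); last by move=> b; rewrite /w => ->.
rewrite sumr_const -mulr_natr ler_wpM2l // ler_nat.
have := card_reach acc j; rewrite cardsE => /leq_trans; apply.
by have [->|c_gt0] := posnP (2 * c); rewrite ?expn0 ?leq_exp2r.
Qed.

(** Induction that sums out the most recent value first: for fixed earlier values it contributes one
    factor from [mgf_nreach]. *)
Lemma mgf_score q : (q <= r)%N ->
  \sum_(t : q.-tuple (Out m d)) lam ^+ score t <= (Psi_card + lam * D) ^+ (d * q).
Proof.
have lam_ge0 : 0 <= lam by apply: le_trans lam_ge1.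
elim: q => [|q IHq] lt_r.
  rewrite muln0 expr0 (big_pred1 [tuple]) ?expr0 //= => t.
  by rewrite [t]tuple0; apply/esym/eqP.
rewrite (reindex (fun p : q.-tuple (Out m d) * Out m d => [tuple of p.2 :: p.1])) /=; last first.
  exists (fun t : q.+1.-tuple (Out m d) => ([tuple of behead t] : q.-tuple _, thead t)) => [[t a] _|t _] /=.
    by congr pair; apply: val_inj.
  by rewrite -tuple_eta.
rewrite -(pair_big predT predT (fun (t : q.-tuple (Out m d)) a => lam ^+ score (a :: t))) /=.
have le_sum (t : q.-tuple (Out m d)) : \sum_a lam ^+ score (a :: t) <=
    (Psi_card + lam * D) ^+ d * lam ^+ score t.
  under eq_bigr do rewrite /= exprD.
  rewrite -big_distrl /= ler_wpM2r ?exprn_ge0 // mgf_nreach ?size_tuple //.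
apply: (le_trans (ler_sum _ (fun t _ => le_sum t))).
rewrite -big_distrr /= mulnS exprD ler_wpM2l ?IHq ?(ltnW lt_r) //.
by rewrite exprn_ge0 // addr_ge0 ?mulr_ge0 ?ler0n.
Qed.

End MGF.
End Score.

(* Abel summation. *)
Lemma sum_weighted_le (F : realFieldType) (I : Type) (x0 : I) (f w : I -> F) (s : seq I) :
    sorted (fun a b : I => w b <= w a) s ->
    (forall r, (r <= size s)%N -> \sum_(a <- take r s) f a <= 0) ->
  \sum_(a <- s) f a * w a <= (\sum_(a <- s) f a) * w (last x0 s).
Proof.
elim/last_ind: s => [|s x IHs]; first by move=> _ _; rewrite !big_nil mul0r.
move=> s_sorted s_neg; rewrite -cats1 !big_cat !big_seq1 /= mulrDl cats1 last_rcons.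
rewrite lerD2r.
have s_sorted' : sorted (fun a b : I => w b <= w a) s.
  by move: s_sorted; case: (s) => //= a l; rewrite rcons_path => /andP[].
apply: le_trans (IHs s_sorted' _) _ => [r le_r|].
  by have := s_neg r; rewrite size_rcons ltnW // -cats1 takel_cat //; apply.
(* The sum over [s] is nonpositive, so lowering its weight from that of the last entry of [s] to
   [w x] can only raise the product. *)
have : \sum_(a <- s) f a <= 0.
  by have := s_neg (size s); rewrite size_rcons leqnSn -cats1 take_size_cat //; apply.
move: s_sorted; case: (s) => [|a l] /=; first by rewrite big_nil !mul0r.
by rewrite rcons_path => /andP[_ le_w] le0; rewrite ler_wnM2l.
Qed.

(** Were all nonempty prefix sums negative, the weighted sum would be at most the full sum times the
    last weight, hence negative. *)
Lemma exists_prefix_sum_ge0 (F : realFieldType) (I : Type) (f w : I -> F) (s : seq I) :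
    sorted (fun a b : I => w b <= w a) s -> all (fun a => 0 < w a) s ->
    (0 < size s)%N -> 0 <= \sum_(a <- s) f a * w a ->
  exists2 r, (0 < r <= size s)%N & 0 <= \sum_(a <- take r s) f a.
Proof.
move=> s_sorted w_gt0 s_gt0 sum_ge0.
have [/existsP[r ?]|/existsPn neg] :=
    boolP [exists r : 'I_(size s), 0 <= \sum_(a <- take r.+1 s) f a].
  by exists r.+1; rewrite //= ltn_ord.
have {}neg r : (0 < r <= size s)%N -> \sum_(a <- take r s) f a < 0.
  by case: r => // r /= lt_r; rewrite ltNge; apply: (neg (Ordinal lt_r)).
have [x0 last_gt0] : exists x0, 0 < w (last x0 s).
  by case: s w_gt0 s_gt0 {s_sorted sum_ge0 neg} => // a l;
    rewrite lastI all_rcons => /andP[? _] _; exists a; rewrite last_rcons.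
have le0 r : (r <= size s)%N -> \sum_(a <- take r s) f a <= 0.
  by case: r => [|r] le_r; [rewrite take0 big_nil | rewrite ltW ?neg].
have := le_trans sum_ge0 (sum_weighted_le x0 s_sorted le0).
by rewrite pmulr_lge0 // leNgt -{1}[s]take_size neg // s_gt0 leqnn.
Qed.

(** * From few output characters to a prefix of high score *)

Section Prefix.
Variables (n c m d : nat) (T : Tables n c m d) (X : {set Key n c}).

Definition tabc (a : 'I_c * 'I_n) : Out m d := T a.1 a.2.
Definition occ (a : 'I_c * 'I_n) : nat := #|[set x in X | x a.1 == a.2]|.

Lemma sum_occ : (\sum_a occ a = c * #|X|)%N.
Proof.
rewrite -(pair_big predT predT (fun i a => occ (i, a))) /=.
rewrite (eq_bigr (fun=> #|X|)) ?sum_nat_const ?card_ord // => i _.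
rewrite -[RHS]sum1_card (partition_big (fun x : Key n c => x i) predT) //=.
by apply: eq_bigr => a _; rewrite /occ -sum1_card; apply: eq_bigl => x; rewrite inE.
Qed.

Lemma n_opcE : n_opc T X = (\sum_j #|[set htab T x j | x in X]|)%N.
Proof.
pose S := [set p : 'I_d * Psi m | p.2 \in [set htab T x p.1 | x in X]].
transitivity #|S|.
  apply: eq_card => -[j a]; rewrite inE /=; apply/imset2P/imsetP.
    by case=> x j' xX _ [-> ->]; exists x.
  by case=> x xX ->; exists x j; rewrite ?inE.
rewrite -sum1dep_card -(pair_big_dep predT (fun j a => a \in [set htab T x j | x in X]) (fun _ _ => 1%N)) /=.
by apply: eq_bigr => j _; rewrite sum1_card.
Qed.

Section Order.
Variable s : seq ('I_c * 'I_n).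
Hypotheses (s_uniq : uniq s) (s_occ : forall a, (0 < occ a)%N -> a \in s).

(** Reversed because [reach] and [score] expect the most recent value first. *)
Definition before a := [seq tabc b | b <- rev (take (index a s) s)].

Lemma occ_key x i : x \in X -> (i, x i) \in s.
Proof. by move=> xX; apply/s_occ/card_gt0P; exists x; rewrite !inE xX eqxx. Qed.

Lemma collision_reach (x y : Key n c) (j : 'I_d) :
    x \in X -> y \in X -> x != y -> htab T x j = htab T y j ->
  exists2 a, (x a.1 == a.2) || (y a.1 == a.2) & reach c (before a) j (tabc a j).
Proof.
move=> xX yX neq_xy eq_h.
(* The 2c slots z: a position, and a bit choosing the key. [P] keeps the positions where the keys
   differ, and [z0] is the slot whose character comes last in [s]. *)
pose char (z : 'I_c * bool) := (z.1, if z.2 then x z.1 else y z.1).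
have char_s z : char z \in s by case: z => i [] /=; apply: occ_key.
pose P (z : 'I_c * bool) := x z.1 != y z.1.
have [i0 Pi0] : exists i, x i != y i.
  apply/existsP; apply: contraR neq_xy => /existsPn eq_xy.
  by apply/eqP/ffunP => i; apply/eqP; have := eq_xy i; rewrite negbK.
have P0 : P (i0, true) by [].
pose z0 := [arg max_(z > (i0, true) | P z) index (char z) s].
have [{}Pz0 z0_max] : P z0 /\ forall z, P z -> (index (char z) s <= index (char z0) s)%N.
  by rewrite /z0; case: arg_maxnP.
have lt_index z : P z -> z != z0 -> (index (char z) s < index (char z0) s)%N.
  move=> Pz neq_z; rewrite ltn_neqAle z0_max // andbT.
  apply: contra neq_z => /eqP eq_i.
  have /eqP : char z = char z0.
    by rewrite -(nth_index (char z) (char_s z)) eq_i nth_index.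
  (* Equal characters share their position, so distinct slots would hold the two keys' characters
     there, which differ by [P]. *)
  rewrite xpair_eqE => /andP[/eqP eq1]; move: Pz; rewrite /P; case: (z) (z0) eq1 => [i b] [i' b'] /= <-.
  by case: b b' => [] [] //= neq; rewrite ?(negbTE neq) // eq_sym (negbTE neq).
have before_mem z : P z -> z != z0 -> tabc (char z) \in before (char z0).
  move=> Pz neq_z; apply: map_f; rewrite mem_rev.
  by rewrite in_take ?lt_index.
exists (char z0); first by rewrite /char /=; case: z0.2; rewrite eqxx ?orbT.
pose v z : Out m d := if P z && (z != z0) then tabc (char z) else 0.
(* Where the keys agree their two table values cancel, so the equality of hashes at [j] leaves only
   the symmetric difference. *)
have sum0 : \sum_z (if P z then tabc (char z) j else 0) = 0.
  rewrite -(pair_big predT predT (fun i b => if P (i, b) then tabc (char (i, b)) j else 0)) /=.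
  rewrite (eq_bigr (fun i => T i (x i) j + T i (y i) j)); last first.
    move=> i _; rewrite big_bool /P /tabc /=.
    by case: eqVneq => [->|//]; rewrite addPsi addr0.
  by move: eq_h; rewrite big_split /= !htabE !sum_ffunE => ->; apply: addPsi.
have -> : tabc (char z0) j = \sum_z v z j.
  rewrite (bigD1 z0) //= Pz0 in sum0.
  rewrite (bigD1 z0) //= {1}/v eqxx andbF ffunE add0r.
  have -> : \sum_(z | z != z0) v z j =
      \sum_(z | z != z0) if P z then tabc (char z) j else 0.
    by apply: eq_bigr => z neq_z; rewrite /v neq_z andbT; case: ifP; rewrite // ffunE.
  by apply: (addIr (\sum_(z | z != z0) if P z then tabc (char z) j else 0)); rewrite sum0 addPsi.
apply: reach_sum.
  (* The other key's character at the same position precedes that of [z0], so [before] is nonempty,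
     as [reach] requires. *)
  pose z1 := (z0.1, ~~ z0.2).
  have neq_z1 : z1 != z0 by rewrite /z1; case: (z0) => i []; rewrite xpair_eqE ?andbF.
  by have := before_mem z1 Pz0 neq_z1; case: (before _).
move=> z; rewrite /v; case: ifP => [/andP[Pz neq_z]|_]; rewrite inE ?eqxx //.
by rewrite before_mem ?orbT.
Qed.


(** Keys without a character bad at [j] are counted by their outputs; the others are covered by the
    key sets of the bad characters, of size [occ a] each. *)
Lemma card_loss (j : 'I_d) :
  (#|X| <= #|[set htab T x j | x in X]| +
     \sum_(a <- s | reach c (before a) j (tabc a j)) occ a)%N.
Proof.
pose bad a := reach c (before a) j (tabc a j).
pose X1 := [set x in X | [forall a, bad a ==> (x a.1 != a.2)]].
have inj : {in X1 &, injective (fun x => htab T x j)}.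
  move=> x y; rewrite !inE => /andP[xX /forallP xP] /andP[yX /forallP yP] eq_h.
  apply/eqP/idPn => neq_xy; have [a] := collision_reach xX yX neq_xy eq_h.
  by have := xP a; have := yP a; rewrite /bad => /implyP ya /implyP xa /orP[/eqP ax|/eqP ax] /[dup] /xa /eqP // _ /ya /eqP.
rewrite -(cardsID X1 X) leq_add //.
  rewrite (setIidPr _); last by apply/subsetP => x; rewrite inE => /andP[].
  rewrite -(card_in_imset inj); apply/subset_leq_card/imsetS/subsetP => x.
  by rewrite inE => /andP[].
have sub : X :\: X1 \subset \bigcup_(a in [set a in s | bad a]) [set x in X | x a.1 == a.2].
  apply/subsetP => x; rewrite !inE => /andP[+ xX]; rewrite xX /= => /forallPn[a].
  rewrite negb_imply negbK => /andP[bad_a /eqP xa]; apply/bigcupP; exists a.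
    rewrite inE bad_a andbT; case: a xa {bad_a} => i a /= <-; exact: occ_key.
  by rewrite inE xX xa eqxx.
apply: leq_trans (subset_leq_card sub) _.
have card_U (A : {set 'I_c * 'I_n}) (B : 'I_c * 'I_n -> {set Key n c}) :
    (#|\bigcup_(a in A) B a| <= \sum_(a in A) #|B a|)%N.
  elim/big_ind2: _ => [|k1 A1 k2 A2 le1 le2|//]; first by rewrite cards0.
  by apply: leq_trans (leq_add le1 le2); rewrite cardsU leq_subr.
apply: leq_trans (card_U _ _) _.
rewrite -[X in (_ <= X)%N]big_filter big_uniq ?filter_uniq //=.
rewrite leq_eqVlt; apply/orP; left; apply/eqP/eq_bigl => a.
by rewrite inE mem_filter andbC.
Qed.

Lemma sum_card_loss :
  (d * #|X| <= n_opc T X + \sum_(a <- s) nreach c (before a) (tabc a) * occ a)%N.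
Proof.
rewrite -[d in (d * _)%N]card_ord -sum_nat_const.
apply: leq_trans (leq_sum _ (fun j _ => card_loss j)) _.
rewrite big_split -n_opcE leq_add2l /= (exchange_big_dep predT) //=.
apply: leq_sum => a _; rewrite sum_nat_const /nreach.
by rewrite leq_mul2r; apply/orP; right; apply/subset_leq_card/subsetP => j; rewrite !inE.
Qed.

(** Since [s] has no repetition, [index] recovers positions, and the tail met by [score] at each
    character is its [before] list. *)
Lemma score_take r : (r <= size s)%N ->
  score c [seq tabc b | b <- rev (take r s)] =
  \sum_(a <- take r s) nreach c (before a) (tabc a).
Proof.
elim: r => [|r IHr] lt_r; first by rewrite take0 big_nil.
have [a0 _] : exists a0 : 'I_c * 'I_n, true by case: (s) lt_r => // a; exists a.
rewrite (take_nth a0) // rev_rcons /= IHr ?(ltnW lt_r) // -cats1 big_cat big_seq1 /= addnC.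
by rewrite /before index_uniq.
Qed.

End Order.

Lemma exists_prefix (F : realFieldType) (theta : F) :
    0 < theta -> (0 < c)%N -> (0 < d)%N -> (0 < #|X|)%N ->
    (n_opc T X)%:R <= (1 - theta) * d%:R * #|X|%:R ->
  exists s : seq ('I_c * 'I_n), [/\ uniq s, (1 < size s)%N, (size s <= c * #|X|)%N,
    forall i, (#|[set a | (i, a) \in s]| <= #|X|)%N &
    theta * d%:R * (size s)%:R <= c%:R * (score c [seq tabc a | a <- s])%:R].
Proof.
move=> theta_gt0 c_gt0 d_gt0 X_gt0 few.
pose s := sort (fun a b => occ b <= occ a)%N [seq a <- enum {: 'I_c * 'I_n} | (0 < occ a)%N].
have s_uniq : uniq s by rewrite sort_uniq filter_uniq ?enum_uniq.
have mem_s a : (a \in s) = (0 < occ a)%N by rewrite mem_sort mem_filter mem_enum andbT.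
have s_occ a : (0 < occ a)%N -> a \in s by rewrite mem_s.
have s_sorted : sorted (fun a b => (occ b)%:R <= (occ a)%:R :> F) s.
  have := sort_sorted (fun a b => leq_total (occ b) (occ a)) [seq a <- enum {: 'I_c * 'I_n} | (0 < occ a)%N].
  by apply: sub_sorted => a b; rewrite ler_nat.
have s_pos : all (fun a => 0 < (occ a)%:R :> F) s.
  by apply/allP => a; rewrite mem_s ltr0n.
have sum_s : (\sum_(a <- s) occ a = c * #|X|)%N.
  rewrite -sum_occ big_uniq //= big_mkcond; apply: eq_bigr => a _.
  by rewrite mem_s; case: posnP => [->|].
have size_s : (size s <= c * #|X|)%N.
  rewrite -sum_s -sum1_size big_seq [X in (_ <= X)%N]big_seq.
  by apply: leq_sum => a; rewrite mem_s.
(* Excess of c m_p over theta d. Weighted by [occ], it has a nonnegative sum because the [occ a] add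
   up to c |X|. *)
pose f a := c%:R * (nreach c (before s a) (tabc a))%:R - theta * d%:R : F.
have f_ge0 : 0 <= \sum_(a <- s) f a * (occ a)%:R.
  have -> : \sum_(a <- s) f a * (occ a)%:R =
      c%:R * (\sum_(a <- s) nreach c (before s a) (tabc a) * occ a)%:R -
      theta * d%:R * (c * #|X|)%:R.
    rewrite -sum_s !natr_sum !big_distrr /= -sumrB; apply: eq_bigr => a _.
    by rewrite mulrBl natrM mulrA.
  have := sum_card_loss s_uniq s_occ; rewrite -(ler_nat F) natrD natrM => loss.
  rewrite natrM subr_ge0 mulrCA ler_wpM2l ?ler0n //.
  by move: few loss; rewrite mulrBl mul1r mulrBl; set A := theta * _ * _; lra.
have s_gt0 : (0 < size s)%N.
  rewrite lt0n; apply: contraL c_gt0 => /nilP s0.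
  by move/eqP: sum_s; rewrite s0 big_nil eq_sym muln_eq0 -leqn0 -[#|X| == _]negbK -lt0n X_gt0 orbF -ltnNge ltnS.
have [r /andP[r_gt0 le_r] sum_ge0] := exists_prefix_sum_ge0 s_sorted s_pos s_gt0 f_ge0.
have size_r : size (rev (take r s)) = r by rewrite size_rev size_takel.
have score_ge : theta * d%:R * r%:R <= c%:R * (score c [seq tabc a | a <- rev (take r s)])%:R.
  rewrite score_take // natr_sum big_distrr /= -subr_ge0; apply: le_trans sum_ge0 _.
  rewrite sumrB lerD2l lerN2 -[in r%:R]size_r size_rev -sum1_size natr_sum big_distrr /=.
  by under eq_bigr do rewrite mulr1.
exists (rev (take r s)); rewrite size_r; split => //.
- by rewrite rev_uniq take_uniq.
(* Length 1 is impossible: a first character is never bad, so its score is 0. The later series thus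
   starts at [rho ^+ 2], the source of the factor |Phi|^2. *)
- rewrite ltn_neqAle r_gt0 andbT; apply: contraL score_ge => /eqP r1.
  have [a s1] : exists a, rev (take r s) = [:: a].
    by move: size_r; rewrite -r1; case: (rev _) => [|a []] // _; exists a.
  have -> : score c [seq tabc a | a <- rev (take r s)] = 0%N.
    by rewrite s1 /= addn0; apply: eq_card0 => j; rewrite inE.
  rewrite -ltNge -r1.
  by rewrite mulr0 mulr1 mulr_gt0 ?ltr0n.
- exact: leq_trans le_r size_s.
(* Every listed character at position [i] is [x i] for some key of [X]; this is why [k]-independence
   suffices. *)
move=> i; apply: leq_trans (leq_imset_card (fun x : Key n c => x i) (mem X)).
apply/subset_leq_card/subsetP => a; rewrite inE mem_rev => /mem_take.
rewrite mem_s => /card_gt0P[x]; rewrite inE /= => /andP[xX /eqP <-].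
exact: imset_f.
Qed.

End Prefix.

Lemma kindepP n m d (K : nat) (f : Table n m d -> R) : kindep K f ->
  (forall g, 0 <= f g) /\
  forall (S : {set 'I_n}) (y : Table n m d), (#|S| <= K)%N ->
    \sum_(g : Table n m d | [forall a in S, g a == y a]) f g
      = (2 ^ (m * d))%:R ^- #|S|.
Proof.
case=> f_ge0 fP; split=> [g|S y le_S]; first exact/RleP.
have := fP S y le_S.
by rewrite RpowE INRE RinvE exprVn !card_ffun card_bool !card_ord expnM.
Qed.

(** * Markov's inequality and the union bound over prefixes *)

Section Union.
Variables (n c m d : nat) (w : 'I_c -> Table n m d -> R).
Let W (T : Tables n c m d) := \prod_i w i (T i).

Lemma probE (E : Tables n c m d -> bool) : prob w E = \sum_(T | E T) W T.
Proof. by []. Qed.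

Section Marginal.
Variable K : nat.
Hypothesis w_indep : forall i, kindep K (w i).

Lemma weight_ge0 T : 0 <= W T.
Proof. by apply: prodr_ge0 => i _; case: (kindepP (w_indep i)). Qed.

Lemma le_prob (E1 E2 : Tables n c m d -> bool) : (forall T, E1 T -> E2 T) -> prob w E1 <= prob w E2.
Proof.
move=> sub; rewrite !probE [X in _ <= X](bigID E1) /=.
rewrite (eq_bigl E1) => [|T]; last by case: (E1 T) (sub T) => [->|]; rewrite ?andbF.
by rewrite lerDl sumr_ge0 // => T _; apply: weight_ge0.
Qed.

(** The tables are mutually independent, so the sum factors over positions, and [kindep] evaluates
    each factor. *)
Lemma prob_agree (S : 'I_c -> {set 'I_n}) (Y : Tables n c m d) : (forall i, (#|S i| <= K)%N) ->
  \sum_(T : Tables n c m d | [forall i, forall a in S i, T i a == Y i a]) W T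
    = (2 ^ (m * d))%:R ^- (\sum_i #|S i|).
Proof.
move=> le_S.
transitivity (\prod_i \sum_(g : Table n m d | [forall a in S i, g a == Y i a]) w i g).
  under [RHS]eq_bigr do rewrite big_mkcond /=.
  rewrite bigA_distr_bigA big_mkcond /=; apply: eq_bigr => T _.
  case: ifPn => [/forallP TP|/forallPn[i Ti]].
    by apply: eq_bigr => i _; rewrite TP.
  by rewrite (bigD1 i) //= (negbTE Ti) mul0r.
under eq_bigr => i _ do rewrite (kindepP (w_indep i)).2 //.
by rewrite prodfV -expr_sum.
Qed.

Lemma prob_le1 (E : Tables n c m d -> bool) : prob w E <= 1.
Proof.
have all_1 : prob w xpredT = 1.
  have S0 (i : 'I_c) : (#|set0 : {set 'I_n}| <= K)%N by rewrite cards0.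
  have := prob_agree [ffun=> [ffun=> 0]] S0.
  under [X in _ ^- X]eq_bigr do rewrite cards0.
  rewrite sum_nat_const muln0 expr0 invr1 => <-; rewrite probE; apply: eq_bigl => T.
  by apply/esym/forallP => i; apply/forallP => a; rewrite inE.
by apply: le_trans (_ : prob w xpredT <= 1); [apply: le_prob | rewrite all_1].
Qed.

Variables (r : nat) (s : r.-tuple ('I_c * 'I_n)).
Hypotheses (s_uniq : uniq s) (s_K : forall i, (#|[set a | (i, a) \in s]| <= K)%N).

Lemma prob_values (y : r.-tuple (Out m d)) :
  \sum_(T : Tables n c m d | map_tuple (tabc T) s == y) W T = (2 ^ (m * d))%:R ^- r.
Proof.
(* Tables prescribing the values [y] at the characters of [s]; agreement is only tested there. *)
pose Y : Tables n c m d := [ffun i => [ffun a => nth 0 y (index (i, a) s)]].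
have := prob_agree Y s_K.
rewrite (_ : (\sum_i _)%N = r); last first.
  transitivity #|[set a | a \in s]|; last by rewrite cardsE (card_uniqP s_uniq) size_tuple.
  rewrite -sum1_card (eq_bigl (mem s)) => [|a]; last by rewrite inE.
  rewrite (eq_bigl (fun a => true && ((a.1, a.2) \in s))) => [|[]] //.
  rewrite -(pair_big_dep predT (fun i a => (i, a) \in s) (fun _ _ => 1%N)) /=.
  by apply: eq_bigr => i _; rewrite -sum1_card; apply: eq_bigl => a; rewrite inE.
move=> <-; apply: eq_bigl => T; apply/eqP/forallP => [Ty i|TY].
  apply/forall_inP => a; rewrite inE => ias; apply/eqP; rewrite !ffunE -Ty /=.
  by rewrite (nth_map (i, a)) ?index_mem // nth_index.
apply: val_inj; apply: (@eq_from_nth _ 0); rewrite ?size_map ?size_tuple // => p lt_p.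
have [a0 _] : exists a0 : 'I_c * 'I_n, true.
  by case: (tval s) (size_tuple s) lt_p => [<-|a] //; exists a.
rewrite (nth_map a0) ?size_tuple //.
have := TY (nth a0 s p).1 => /forall_inP/(_ (nth a0 s p).2).
rewrite inE -surjective_pairing mem_nth ?size_tuple // => /(_ isT)/eqP.
by rewrite !ffunE -surjective_pairing index_uniq ?size_tuple.
Qed.

(** Grouping tables by their values on [s] makes these values uniform. [mgf_score] then bounds the
    mean by the (d r)-th power of 1 + lam r^(2c) / 2^m, which is at most 2. *)
Lemma mgf_prob (lam : R) : 1 <= lam -> lam * (r ^ (2 * c))%:R <= (2 ^ m)%:R ->
  \sum_T lam ^+ score c [seq tabc T a | a <- s] * W T <= 2 ^+ (d * r).
Proof.
move=> lam_ge1 lam_le.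
rewrite (partition_big (fun T => map_tuple (tabc T) s) predT) //=.
rewrite (eq_bigr (fun y : r.-tuple (Out m d) => lam ^+ score c y * (2 ^ (m * d))%:R ^- r)); last first.
  by move=> y _; rewrite -(prob_values y) big_distrr; apply: eq_bigr => T /eqP <-.
have Psi_gt0 : 0 < (2 ^ m)%:R :> R by rewrite ltr0n expn_gt0.
rewrite -big_distrl /= ler_pdivrMr ?exprn_gt0 ?ltr0n ?expn_gt0 //.
have := @mgf_score c m d _ lam r lam_ge1 r (leqnn r).
move=> mgf; apply: (le_trans mgf) => {mgf}.
have -> : (2 ^ (m * d))%:R = (2 ^ m)%:R ^+ d :> R by rewrite expnM natrX.
rewrite -[X in _ <= _ * X]exprM -exprMn.
have D_ge0 : 0 <= lam * (r ^ (2 * c))%:R.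
  by apply: mulr_ge0; [apply: le_trans lam_ge1; exact: ler01 | exact: ler0n].
by rewrite lerXn2r ?nnegrE //; lra.
Qed.

End Marginal.

Lemma geometric_tail (rho : R) N : 0 <= rho -> rho <= 2^-1 ->
  \sum_(i < N) rho ^+ i.+2 <= 2 * rho ^+ 2.
Proof.
move=> rho_ge0 rho_le.
(* The subtracted term lets the induction close, since rho <= 1/2. *)
suff: \sum_(i < N) rho ^+ i.+2 <= 2 * rho ^+ 2 - 2 * rho ^+ N.+2.
  by move=> /le_trans; apply; rewrite gerBl mulr_ge0 ?exprn_ge0.
elim: N => [|N IHN]; first by rewrite big_ord0 subrr.
rewrite big_ord_recr /= (exprS _ N.+2).
have : 0 <= rho ^+ N.+2 by rewrite exprn_ge0.
by move: IHN; set x := rho ^+ N.+2; nra.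
Qed.

(** The event implied by both failures, with an integer size bound. *)
Definition few_opc (theta : R) (K : nat) (T : Tables n c m d) : bool :=
  [exists X : {set Key n c}, [&& (0 < #|X|)%N, (#|X| <= K)%N &
     (n_opc T X)%:R <= (1 - theta) * d%:R * #|X|%:R]].

Lemma prob_few_opc (theta lam q : R) (K : nat) :
    0 < theta -> (0 < c)%N -> (0 < d)%N -> (forall i, kindep K (w i)) ->
    1 <= lam -> lam * ((c * K) ^ (2 * c))%:R <= (2 ^ m)%:R ->
    0 < q -> (forall r t : nat, theta * d%:R * r%:R <= c%:R * t%:R -> q ^+ r <= lam ^+ t) ->
    let rho := (c * n)%:R * 2 ^+ d / q in
    rho <= 2^-1 -> prob w (few_opc theta K) <= 2 * rho ^+ 2.
Proof.
move=> theta_gt0 c_gt0 d_gt0 w_indep lam_ge1 lam_le q_gt0 q_le rho rho_le.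
have W_ge0 := weight_ge0 w_indep.
have rho_ge0 : 0 <= rho by rewrite divr_ge0 ?mulr_ge0 ?exprn_ge0 // ltW.
pose ok (s : seq ('I_c * 'I_n)) :=
  uniq s && [forall i, (#|[set a | (i, a) \in s]| <= K)%N].
pose heavy (s : seq ('I_c * 'I_n)) (T : Tables n c m d) :=
  theta * d%:R * (size s)%:R <= c%:R * (score c [seq tabc T a | a <- s])%:R.
apply: le_trans (geometric_tail (c * K).-1 rho_ge0 rho_le).
(* Union bound over admissible lists of length i + 2, that is, from 2 to c K. *)
apply: (@le_trans _ R (\sum_(i < (c * K).-1) \sum_(s : i.+2.-tuple ('I_c * 'I_n) | ok s)
          \sum_(T | heavy s T) W T)).
  rewrite probE.
  under [X in _ <= X]eq_bigr => i _ do rewrite (exchange_big_dep xpredT) //=.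
  rewrite exchange_big /= [X in _ <= X](bigID (few_opc theta K)) /=.
  rewrite -[X in X <= _]addr0 lerD //; last first.
    by do 3! apply: sumr_ge0 => ? _.
  apply: ler_sum => T /existsP[X /and3P[X_gt0 X_le few]].
  have [s [s_uniq s_gt1 s_le s_K s_heavy]] := exists_prefix theta_gt0 c_gt0 d_gt0 X_gt0 few.
  have lt_i : ((size s).-2 < (c * K).-1)%N.
    have : (size s <= c * K)%N by apply: leq_trans s_le _; rewrite leq_mul2l X_le orbT.
    by case: (size s) (c * K)%N s_gt1 => [|[|?]] [|].
  rewrite (bigD1 (Ordinal lt_i)) //=.
  have size_s : size s == (size s).-2.+2 by case: (size s) s_gt1 => [|[|]].
  rewrite (bigD1 (Tuple size_s)) /=; last first.
    rewrite /ok s_uniq /heavy s_heavy andbT /=; apply/forallP => i.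
    exact: leq_trans (s_K i) X_le.
  by rewrite -addrA lerDl addr_ge0 ?sumr_ge0 // => ? _; rewrite ?sumr_ge0.
apply: ler_sum => i _; set r := i.+2.
have heavy_le (s : r.-tuple ('I_c * 'I_n)) : ok s ->
    \sum_(T | heavy s T) W T <= (2 ^+ d / q) ^+ r.
  case/andP=> s_uniq /forallP s_K.
  have le_r : lam * (r ^ (2 * c))%:R <= (2 ^ m)%:R.
    apply: le_trans lam_le; rewrite ler_pM2l ?(lt_le_trans ltr01) // ler_nat.
    by rewrite leq_exp2r ?muln_gt0 //; have := ltn_ord i; rewrite /r ltn_predRL.
  (* Markov's inequality: on a heavy list [lam ^+ score] is at least [q ^+ r]. *)
  have := mgf_prob w_indep s_uniq s_K lam_ge1 le_r.
  rewrite expr_div_n -exprM ler_pdivlMr ?exprn_gt0 //; apply: le_trans.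
  rewrite big_distrl /= big_mkcond; apply: ler_sum => T _ /=.
  have lam_score_ge0 : 0 <= lam ^+ score c [seq tabc T a | a <- s].
    by rewrite exprn_ge0 // (le_trans ler01).
  case: ifP => [|_]; last exact: mulr_ge0.
  rewrite /heavy size_tuple => /q_le le_q; rewrite mulrC.
  exact: ler_wpM2r.
apply: le_trans (ler_sum _ heavy_le) _.
have -> : rho = (c * n)%:R * (2 ^+ d / q) by rewrite mulrA.
(* There are at most (c n)^r lists of length r, which gives the term [rho ^+ r]. *)
rewrite sumr_const -[X in X <= _]mulr_natl [X in _ <= X]exprMn; apply: ler_wpM2r.
  by rewrite exprn_ge0 // divr_ge0 ?exprn_ge0 // ltW.
rewrite -natrX ler_nat; apply: leq_trans (max_card _) _.
by rewrite card_tuple card_prod !card_ord.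
Qed.

End Union.

(* Without this, numerals in [theta] would be parsed in [R_scope], as [IZR]. *)
Arguments few_opc {n c m d} theta%_ring_scope K T.

(** * Both failures produce few output characters *)

Section Events.
Variables (n c m d : nat) (T : Tables n c m d).

Lemma failB_few_opc (eps k : R) (K : nat) :
    0 < eps -> (forall N, Rle (INR N) k -> (N <= K)%N) ->
  failB eps k T -> few_opc (eps / 2) K T.
Proof.
move=> eps_gt0 k_K /existsP[X /and3P[X_gt0 X_le few]]; apply/existsP; exists X.
rewrite X_gt0 /=; apply/andP; split.
  by apply: k_K; move: X_le; rewrite /Defs.Rleb; case: Rle_dec.
move: few; rewrite /many_opc /Defs.Rltb; case: Rlt_dec => // nlt _.
have /RleP := Rnot_lt_le _ _ nlt; rewrite !INRE !RmultE RminusE => few.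
apply: le_trans few _.
rewrite -!mulrA; apply: ler_wpM2r; first exact: mulr_ge0.
rewrite lerD2l lerN2.
by rewrite ler_pdivrMr ?ltr0n // ler_peMr ?ler1n // ltW.
Qed.

(** Without a unique character, every value occurring at a coordinate is shared by at least two
    keys, so each coordinate shows at most |X| / 2 values. *)
Lemma failA_few_opc (k : R) (K : nat) :
    (forall N, Rle (INR N) k -> (N <= K)%N) ->
  failA k T -> few_opc (1 / 2) K T.
Proof.
move=> k_K /existsP[X /and3P[X_gt0 X_le no_unique]]; apply/existsP; exists X.
rewrite X_gt0 /=; apply/andP; split.
  by apply: k_K; move: X_le; rewrite /Defs.Rleb; case: Rle_dec.
suff: (2 * n_opc T X <= d * #|X|)%N.
  by rewrite -(ler_nat R) !natrM; set A := d%:R * _; rewrite -mulrA -/A; lra.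
rewrite n_opcE big_distrr /= -[d in (d * _)%N]card_ord -sum_nat_const.
apply: leq_sum => j _.
rewrite -[#|X|]sum1_card (partition_big_imset (fun x => htab T x j)) /=.
rewrite mulnC -sum_nat_const; apply: leq_sum => a /imsetP[x xX ->].
rewrite sum1dep_card; set S := [set y in X | _].
have S_gt0 : (0 < #|S|)%N by apply/card_gt0P; exists x; rewrite !inE xX eqxx.
have S_neq1 : #|S| != 1%N.
  move: no_unique; rewrite /has_unique_opc negb_exists => /forallP/(_ j).
  by rewrite negb_exists => /forallP/(_ (htab T x j)).
by case: #|S| S_gt0 S_neq1 => [|[|]].
Qed.

End Events.

Lemma le_truncn_INR (k : R) N : 0 <= k -> Rle (INR N) k <-> (N <= Num.truncn k)%N.
Proof.
by move=> k_ge0; rewrite truncn_ge_nat // -INRE; split=> /RleP.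
Qed.

(** * The probability bound for fixed parameters *)

Section Bound.
Local Open Scope R_scope.

Lemma prob_few_opc_bound n c m d (w : 'I_c -> Table n m d -> R) (K : nat) (e dlt : R)
    (Ps := INR (2 ^ m)) (bound := INR n ^ 2 / Rpower Ps (e * INR d / (2 * INR c))) :
    0 < e -> e <= 1 -> (0 < c)%N -> (6 * c <= d)%N -> (forall i, kindep K (w i)) ->
    1 < Ps -> INR K <= Rpower Ps (/ (5 * INR c)) ->
    INR ((c + d) ^ c) <= Rpower Ps (e / 100) ->
    exp (- (3 / 10 * e * ln Ps)) <= dlt / 4 ->
  prob w (few_opc (e / 2) K) <= dlt * bound.
Proof.
move=> e_gt0 e_le1 c_gt0 d_ge w_indep Ps_gt1 K_le Q_le Ps_large.
(* If the claimed bound is at least 1, it holds because probabilities are at most 1; otherwise it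
   forces rho <= 1/2. *)
have [bound_lt|bound_ge] := Rlt_le_dec (dlt * bound) 1; last first.
  by apply: Rle_trans bound_ge; apply/RleP; apply: prob_le1 w_indep _.
have C_ge1 : (1 <= INR c) by apply/RleP; rewrite INRE ler1n.
have D_ge : (6 * INR c <= INR d).
  have -> : 6 = 6%:R :> R by rewrite -INRE INR_IZR_INZ.
  by apply/RleP; rewrite RmultE !INRE -natrM ler_nat.
have N_ge0 := pos_INR n; have K_ge0 := pos_INR K.
have {}Q_le : ((INR c + INR d) ^ c <= Rpower Ps (e / 100)).
  by move: Q_le; rewrite !INRE natrX natrD RpowE.
have rho_half := rho_le_half c d _ _ _ _ e_gt0 e_le1 C_ge1 D_ge Ps_gt1 N_ge0 Q_le Ps_large bound_lt.
have rho_sqr := rho_sqr_le c d _ _ _ _ e_gt0 e_le1 C_ge1 D_ge Ps_gt1 N_ge0 Q_le Ps_large.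
have room := lam_room c d _ _ _ C_ge1 D_ge Ps_gt1 K_ge0 K_le Q_le.
have lam1 := one_le_lam _ _ e_le1 Ps_gt1.
have q_lam := q_le_lam c d _ _ e_le1 C_ge1 Ps_gt1.
have q0 := q_pos c d Ps e.
apply: Rle_trans rho_sqr; apply/RleP.
move: q0 q_lam lam1 room rho_half; set q := Rpower _ (_ * _ * _); set lam := Rpower _ (_ - _).
move=> /RltP q0 q_lam /RleP lam1 /RleP room /RleP rho_half.
have -> : (2 * (INR c * INR n * 2 ^ d / q) ^ 2) = (2 * ((c * n)%:R * 2 ^+ d / q) ^+ 2)%R :> R.
  by rewrite !RpowE !RdivE !RmultE !INRE natrM.
apply: (prob_few_opc (lam := lam)) => //.
- by apply: divr_gt0; [apply/RltP | rewrite ltr0n].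
- by apply: leq_trans d_ge; rewrite muln_gt0.
- by move: room; rewrite /Ps RpowE !RmultE !INRE -natrM -natrX.
- move=> r t le_rt; apply/RleP; rewrite -!RpowE; apply: q_lam.
  by apply/RleP; rewrite RdivE !RmultE !INRE.
- by move: rho_half; rewrite RdivE !RmultE !RpowE !INRE natrM.
Qed.

End Bound.

Lemma kindep_unif n c m d K (i : 'I_c) : kindep K (@unif n c m d i).
Proof.
have card_gt0 : (0 < #|{: Out m d}|)%N by rewrite !card_ffun !card_ord card_bool !expn_gt0.
set q := #|{: Out m d}| in card_gt0 *.
have card_T : #|{: Table n m d}| = (q ^ n)%N by rewrite card_ffun card_ord.
split=> [f|S y _]; rewrite /unif card_T INRE RinvE; first by apply/RleP; rewrite invr_ge0.
rewrite -/q RpowE INRE RinvE.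
(* Uniform weight times the indicator of agreement, factored over characters: a factor sums to 1/q
   inside [S] and to 1 outside. *)
pose v a b : R := if (a \in S) ==> (b == y a) then q%:R^-1 else 0.
transitivity (\sum_(f : Table n m d) \prod_a v a (f a)).
  rewrite [LHS]big_mkcond; apply: eq_bigr => f _; case: ifPn => [/forallP agree|/forallPn[a disagree]].
    by rewrite (eq_bigr (fun=> q%:R^-1)) => [|a _]; rewrite ?prodr_const ?card_ord ?exprVn ?natrX // /v agree.
  by rewrite (bigD1 a) //= /v (negbTE disagree) mul0r.
rewrite -(bigA_distr_bigA v) (bigID (mem S)) /= [X in _ * X]big1 ?mulr1 => [|a aS].
  rewrite -prodr_const; apply: eq_bigr => a aS; rewrite (bigD1 (y a)) //= big1 => [|b neq_b].
    by rewrite /v eqxx implybT addr0.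
  by rewrite /v aS (negbTE neq_b).
rewrite (eq_bigr (fun=> q%:R^-1)) => [|b _]; last by rewrite /v (negbTE aS).
by rewrite sumr_const -[LHS]mulr_natr mulVf // pnatr_eq0 -lt0n.
Qed.

(** * Passage to the limit *)

Section Asymptotics.
Local Open Scope R_scope.
Variables (c d m : nat -> nat).
Hypotheses (c_gt0 : forall n, (0 < c n)%N) (d_ge : forall n, (6 * c n <= d n)%N).
Hypothesis Q_small : small_pow (fun n => INR ((c n + d n) ^ c n)) (fun n => INR (2 ^ m n)).

Lemma eventually_and (P Q : nat -> Prop) :
  eventually P -> eventually Q -> eventually (fun n => P n /\ Q n).
Proof.
move=> [N1 P1] [N2 Q2]; exists (maxn N1 N2) => n; rewrite geq_max => /andP[le1 le2].
by split; [apply: P1 | apply: Q2].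
Qed.

Lemma eventually_lnPsi_ge B : 0 < B -> eventually (fun n => B <= ln (INR (2 ^ m n))).
Proof.
move=> B_gt0.
have ln2_gt0 : 0 < ln 2 by rewrite -ln_1; apply: ln_increasing; Lra.lra.
have [N NP] := Q_small (Rdiv_lt_0_compat _ _ ln2_gt0 B_gt0); exists N => n /NP.
apply: ln_ge_of_Rpower B_gt0 _.
apply: (Rle_trans _ (INR 2)); first by rewrite INR_IZR_INZ; apply: Rle_refl.
apply: le_INR; apply/ssrnat.leP; apply: (@leq_trans ((c n + d n) ^ 1)).
  rewrite expn1; apply: leq_trans (leq_addl _ _); apply: leq_trans (d_ge n).
  by apply: (@leq_trans (6 * 1)); rewrite ?leq_mul2l ?c_gt0.
by rewrite leq_pexp2l // addn_gt0 c_gt0.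
Qed.

Lemma little_o_few_opc (K : nat -> nat) (w : forall n, 'I_(c n) -> Table n (m n) (d n) -> R)
    (fail : forall n, Tables n (c n) (m n) (d n) -> bool) (e : R) :
    0 < e -> e <= 1 ->
    (forall n, INR (K n) <= Rpower (INR (2 ^ m n)) (/ (5 * INR (c n)))) ->
    (forall n i, kindep (K n) (w n i)) ->
    (forall n T, fail n T -> few_opc (e / 2) (K n) T) ->
  little_o (fun n => prob (w n) (@fail n))
    (fun n => INR n ^ 2 / Rpower (INR (2 ^ m n)) (e * INR (d n) / (2 * INR (c n)))).
Proof.
move=> e_gt0 e_le1 K_le w_indep fail_few dlt dlt_gt0.
(* The first entry ensures |Psi| > 1, the second makes the leftover power of |Psi| at most
   [dlt / 4]. *)
pose B := Rmax 1 (- ln (dlt / 4) / (3 / 10 * e)).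
have B_ge1 : 1 <= B by apply: Rmax_l.
have B_gt0 : 0 < B by Lra.lra.
have e100_gt0 : 0 < e / 100 by Lra.lra.
have [N NP] := eventually_and (eventually_lnPsi_ge B_gt0) (Q_small e100_gt0).
exists N => n /NP[L_ge Q_le] {N NP}.
rewrite Rabs_right; last first.
  by apply/Rle_ge/RleP; apply: sumr_ge0 => T _; apply: weight_ge0 (w_indep n) _.
apply: Rle_trans (prob_few_opc_bound (K := K n) e_gt0 e_le1 (c_gt0 n) (d_ge n) (w_indep n) _ _ Q_le _) => //.
- by apply/RleP; apply: le_prob (w_indep n) _ _ (@fail_few n).
- apply: ln_lt_inv; first by Lra.lra.
    by apply: lt_0_INR; apply/ssrnat.ltP; rewrite expn_gt0.
  by rewrite ln_1; Lra.lra.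
by apply: exp_opp_le; [Lra.lra | Lra.lra | apply: Rle_trans L_ge; apply: Rmax_r].
Qed.

End Asymptotics.

Theorem theorem1 (c d m : nat -> nat)
  (Hc1 : forall n, (1 <= c n)%N) (Hd1 : forall n, (1 <= d n)%N)
  (Hd6 : forall n, (6 * c n <= d n)%N)
  (Hc : small_pow (fun n => INR (c n)) (fun n => INR n))
  (Hcd : small_pow (fun n => INR ((c n + d n) ^ c n)) (fun n => INR (2 ^ m n))) :
  let kk n := Rpower (INR (2 ^ m n)) (Rinv (Rmult 5 (INR (c n)))) in
  let bnd e n := Rdiv (pow (INR n) 2)
                      (Rpower (INR (2 ^ m n)) (Rdiv (Rmult e (INR (d n))) (Rmult 2 (INR (c n))))) in
  (* (a), (b) for fully random character tables *)
  little_o (fun n => prob (@unif n (c n) (m n) (d n)) (failA (kk n))) (bnd R1)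
  /\ (forall eps : R, Rlt R0 eps -> Rlt eps R1 ->
        little_o (fun n => prob (@unif n (c n) (m n) (d n)) (failB eps (kk n))) (bnd eps))
  (* (a), (b) for mutually independent, k-independent tables, k <= |Psi|^(1/(5c)) *)
  /\ (forall (K : nat -> nat) (w : forall n, 'I_(c n) -> Table n (m n) (d n) -> R),
        (forall n, Rle (INR (K n)) (kk n)) ->
        (forall n i, kindep (K n) (w n i)) ->
        little_o (fun n => prob (w n) (failA (INR (K n)))) (bnd R1)
        /\ (forall eps : R, Rlt R0 eps -> Rlt eps R1 ->
              little_o (fun n => prob (w n) (failB eps (INR (K n)))) (bnd eps))).
Proof.
move=> kk bnd.
have both (K : nat -> nat) (k : nat -> R) (w : forall n, 'I_(c n) -> Table n (m n) (d n) -> R) :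
    (forall n, Rle (INR (K n)) (kk n)) ->
    (forall n N, Rle (INR N) (k n) -> (N <= K n)%N) ->
    (forall n i, kindep (K n) (w n i)) ->
    little_o (fun n => prob (w n) (failA (k n))) (bnd R1)
    /\ (forall eps : R, Rlt R0 eps -> Rlt eps R1 ->
          little_o (fun n => prob (w n) (failB eps (k n))) (bnd eps)).
  move=> K_le k_K w_indep; split=> [|eps eps_gt0 eps_lt1].
    apply: (little_o_few_opc Hc1 Hd6 Hcd _ _ K_le w_indep) => [||n T].
    - exact: Rlt_0_1.
    - exact: Rle_refl.
    exact: failA_few_opc (k_K n).
  apply: (little_o_few_opc Hc1 Hd6 Hcd eps_gt0 (Rlt_le _ _ eps_lt1) K_le w_indep) => n T.
  by apply: failB_few_opc (k_K n); apply/RltP.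
have kk_ge0 n : 0 <= kk n by apply/RleP/Rlt_le/exp_pos.
(* Sizes are integers, so the real bound [kk n] may be truncated; uniform tables are independent to
   every order. *)
have [A B] := both (fun n => Num.truncn (kk n)) kk (fun n => @unif n (c n) (m n) (d n))
  (fun n => (le_truncn_INR _ (kk_ge0 n)).2 (leqnn _))
  (fun n N => (le_truncn_INR N (kk_ge0 n)).1)
  (fun n i => @kindep_unif _ _ _ _ _ i).
split=> //; split=> // K w K_le w_indep.
by apply: both K_le _ w_indep => n N /INR_le /ssrnat.leP.
Qed.
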